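(* Let $p$ be a prime. Given ordinals $\alpha,\beta\in\mathbf{On}_p$, assume $\alpha=[\sum p^\delta a_\delta]$ and $\beta=[\sum p^\delta b_\delta]$ (base-$p$ expansions: finite sums, each $\delta$ is an ordinal, and every $a_\delta,b_\delta\in p=\{0,\dots,p-1\}$). Then the sum in $\mathbf{On}_p$ is $\alpha+\beta=[\sum p^\delta c_\delta]$, where each $c_\delta\in p$ satisfies $c_\delta\equiv a_\delta+b_\delta \pmod p$.
   Context: Conventions. $p$ is a fixed prime. An expression in square brackets $[\cdots]$ is evaluated with ordinary ordinal arithmetic; unbracketed operations on ordinals are those of $\mathbf{On}_p$. An ordinal $\alpha$ is also identified with the set of all smaller ordinals, so $\beta\in\alpha$ means $\beta<\alpha$. In bracketed sums such as $[\sum\phi^\delta\alpha_\delta]$, the terms are taken in decreasing order of exponent $\delta$. Definition of $\mathbf{On}_p$. $\mathbf{On}_p$ is the Class of all ordinals with addition and multiplication defined along an increasing chain of ordinals $\phi_\Delta$ ($\Delta$ an ordinal), each a field of characteristic $p$ whose operations extend those of the earlier ones: $\phi_0=p$ with arithmetic modulo $p$; for $\Delta$ a limit, $\phi_\Delta=\sup_{\Delta'<\Delta}\phi_{\Delta'}$; for $\Delta$ a successor, write $\phi=\phi_{[\Delta-1]}$, $\widetilde\phi=\phi_\Delta$, and: (i) If $\phi$ is not algebraically closed, let $n$ be the smallest positive integer such that some polynomial of degree $n$ in $\phi[x]$ has no root in $\phi$, and let $h(x)\in\phi[x]$ (of degree $<n$) be the lexicographically earliest polynomial such that $g(x)=x^n-h(x)$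 has no root in $\phi$ (comparing coefficients, as ordinals, from the highest power of $x$ down). Then $\widetilde\phi=[\phi^n]$, and the operations on $\widetilde\phi$ are transported from $\phi[x]/\langle g(x)\rangle$ through the bijection $\theta\left(\left[\sum_{i=0}^{n-1}\phi^i\alpha_i\right]\right)=\sum_{i=0}^{n-1}x^i\alpha_i+\langle g(x)\rangle$ ($\alpha_i\in\phi$). (ii) If $\phi$ is algebraically closed, then $\widetilde\phi=[\phi^\phi]$, and the operations are transported from the rational function field $\phi(x)$ through the bijection $\theta\left(\left[\sum_i\phi^{\omega+\omega\alpha_i+n_i}\beta_i+\sum_j\phi^{m_j}\delta_j\right]\right)=\sum_i\frac{\beta_i}{(x-\alpha_i)^{n_i+1}}+\sum_j x^{m_j}\delta_j$ (finite sums, $\alpha_i,\beta_i,\delta_j\in\phi$, $n_i,m_j\in\omega$; partial fractions). *)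

(* Defs.v *)
From HB Require Import structures.
From mathcomp Require Import all_boot all_order all_algebra.
From mathcomp Require Import generic_quotient fraction qpoly finmap.
From mathcomp Require Import mathcomp_extra boolp classical_sets.

Set Implicit Arguments.
Unset Strict Implicit.
Unset Printing Implicit Defensive.

Import Order.TTheory GRing.Theory.

Declare Scope ord_scope.
Delimit Scope ord_scope with ord.
Local Open Scope order_scope.
Local Open Scope quotient_scope.

(** * The Class of all ordinals

    [node f] is a name for the least ordinal strictly above every [f i].  The
    index types range over one universe, the "small" types; ordinals are names
    up to mutual comparison, so every small family has a supremum while the
    type [Ord] itself is not small. *)

Inductive oname : Type := node (I : Type) of (I -> oname).

Fixpoint oname_le (s t : oname) : Prop :=
  match s, t with
  | node _ f, node _ g => forall i, exists j, oname_le (f i) (g j)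
  end.

Definition oname_lt (s t : oname) : Prop :=
  match t with node _ g => exists j, oname_le s (g j) end.

HB.instance Definition _ := gen_eqMixin oname.
HB.instance Definition _ := gen_choiceMixin oname.

Lemma oname_le_refl s : oname_le s s.
Proof. by elim: s => I f IH /= i; exists i. Qed.

Lemma oname_le_trans t s u : oname_le s t -> oname_le t u -> oname_le s u.
Proof.
elim: s t u => I f IH [J g] [K h] /= st tu i.
have [j fg] := st i; have [k gh] := tu j.
by exists k; apply: (IH i (g j)).
Qed.

Lemma oname_leNlt s t : ~ oname_le s t -> oname_lt t s.
Proof.
elim: s t => I f IH [J g] /= /existsNP[i /forallNP ng].
by exists i; case E: (f i) => [K h] j; have := IH i _ (ng j); rewrite E.
Qed.

Lemma oname_le_lt_trans t s u : oname_le s t -> oname_lt t u -> oname_lt s u.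
Proof. by case: u => K h /= st [k tu]; exists k; apply: oname_le_trans tu. Qed.

Lemma oname_lt_le_trans t s u : oname_lt s t -> oname_le t u -> oname_lt s u.
Proof.
case: t u => J g [K h] /= [j sg] tu; have [k gh] := tu j.
by exists k; apply: oname_le_trans gh.
Qed.

Lemma oname_ltNge s t : oname_lt s t -> ~ oname_le t s.
Proof.
elim: s t => I f IH [J g] /= [j fg] gf; have [i gfi] := gf j.
apply: (IH i (g j)) => //; apply: (@oname_lt_le_trans (node f)) => //=.
by exists i; apply: oname_le_refl.
Qed.


Lemma oname_le_total s t : oname_le s t \/ oname_le t s.
Proof.
have [st|/oname_leNlt ts] := pselect (oname_le s t); first by left.
right; elim: t s ts => J g IH [I f] /= [i gi] j; exists i.
apply: (@oname_le_trans (node g)) => //; apply: IH => /=.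
by exists j; apply: oname_le_refl.
Qed.

Definition oname_eqv (s t : oname) : bool := `[< oname_le s t /\ oname_le t s >].

Fact oname_eqv_refl : reflexive oname_eqv.
Proof. by move=> s; apply/asboolP; split; apply: oname_le_refl. Qed.

Fact oname_eqv_sym : symmetric oname_eqv.
Proof. by move=> s t; apply/asboolP/asboolP => -[]. Qed.

Fact oname_eqv_trans : transitive oname_eqv.
Proof.
move=> t s u /asboolP[st ts] /asboolP[tu ut].
by apply/asboolP; split; apply: (@oname_le_trans t).
Qed.

Canonical oname_eqv_rel :=
  EquivRel oname_eqv oname_eqv_refl oname_eqv_sym oname_eqv_trans.

Definition Ord : Type := {eq_quot oname_eqv_rel}.
HB.instance Definition _ := Choice.on Ord.
HB.instance Definition _ := EqQuotient.on Ord.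

Definition ord_le (a b : Ord) : bool := `[< oname_le (repr a) (repr b) >].

Fact ord_le_refl : reflexive ord_le.
Proof. by move=> a; apply/asboolP; apply: oname_le_refl. Qed.

Fact ord_le_anti : antisymmetric ord_le.
Proof.
move=> a b /andP[/asboolP ab /asboolP ba].
by rewrite -[a]reprK -[b]reprK; apply/eqmodP/asboolP.
Qed.

Fact ord_le_trans : transitive ord_le.
Proof.
move=> b a c /asboolP ab /asboolP bc.
by apply/asboolP; apply: oname_le_trans bc.
Qed.

Fact ord_le_total : total ord_le.
Proof.
move=> a b; apply/orP; have [ab|ba] := oname_le_total (repr a) (repr b).
  by left; apply/asboolP.
by right; apply/asboolP.
Qed.

Fact ord_display : Order.disp_t. Proof. exact: (Order.Disp tt tt). Qed.

HB.instance Definition _ :=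
  Order.Le_isPOrder.Build ord_display Ord ord_le_refl ord_le_anti ord_le_trans.
HB.instance Definition _ :=
  Order.POrder_isTotal.Build ord_display Ord ord_le_total.

Lemma ord_leP (a b : Ord) : (a <= b) <-> oname_le (repr a) (repr b).
Proof. by split=> [/asboolP|?]; last exact/asboolP. Qed.

Lemma ord_ltP (a b : Ord) : (a < b) <-> oname_lt (repr a) (repr b).
Proof.
rewrite ltNge; split=> [/negP ba|ab].
  by apply: oname_leNlt => /ord_leP.
by apply/negP => /ord_leP; apply: oname_ltNge.
Qed.

Lemma repr_pi_le (s : oname) :
  oname_le (repr (\pi_Ord s)) s /\ oname_le s (repr (\pi_Ord s)).
Proof.
have : repr (\pi_Ord s) = s %[mod Ord] by rewrite reprK.
by move=> /eqmodP/asboolP.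
Qed.

Definition olsub (I : Type) (f : I -> Ord) : Ord :=
  \pi_Ord (node (fun i => repr (f i))).

Lemma lt_olsub (I : Type) (f : I -> Ord) (a : Ord) :
  (a < olsub f) <-> exists i, a <= f i.
Proof.
have [le1 le2] := repr_pi_le (node (fun i => repr (f i))).
rewrite ord_ltP; split=> [/oname_lt_le_trans/(_ le1)[i fi]|[i /ord_leP fi]].
  by exists i; apply/ord_leP.
by apply: (oname_lt_le_trans _ le2); exists i.
Qed.

Lemma olsub_le (I : Type) (f : I -> Ord) (a : Ord) :
  (olsub f <= a) <-> forall i, f i < a.
Proof.
split=> [fa i|fa]; first by apply: (lt_le_trans _ fa); apply/lt_olsub; exists i.
by rewrite leNgt; apply/negP => /lt_olsub[i]; rewrite leNgt fa.
Qed.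

Lemma Ord_wf : well_founded (fun a b : Ord => a < b).
Proof.
suff H (s : oname) (a : Ord) : oname_lt (repr a) s -> Acc (fun a b : Ord => a < b) a.
  by move=> a; constructor=> b /ord_ltP; apply: H.
elim: s a => I f IH a /= [i ai]; constructor=> b /ord_ltP ba.
exact/(IH i)/(oname_lt_le_trans ba ai).
Qed.

(* Replacement: the image of an initial segment is bounded. *)
Lemma Ord_replacement (b : Ord) (f : Ord -> Ord) :
  exists c, forall a, a < b -> f a <= c.
Proof.
elim/(well_founded_ind Ord_wf): b f => b IH f.
case E : (repr b) => [I g].
have below a : a < b -> exists i, a <= \pi_Ord (g i).
  move=> /ord_ltP; rewrite E => -[i ai]; exists i; apply/ord_leP.
  by apply: (oname_le_trans ai); case: (repr_pi_le (g i)).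
have gb i : \pi_Ord (g i) < b.
  apply/ord_ltP; rewrite E; exists i; by case: (repr_pi_le (g i)).
have /boolp.choice[c cP] : forall i, exists c, forall a, a < \pi_Ord (g i) -> f a <= c.
  by move=> i; apply: IH (gb i) f.
exists (Order.max (olsub c) (olsub (fun i => f (\pi_Ord (g i))))).
move=> a /below[i]; rewrite le_eqVlt le_max => /orP[/eqP->|ai].
  by apply/orP; right; apply/ltW/lt_olsub; exists i.
apply/orP; left; apply: (le_trans (cP _ _ ai)).
by apply/ltW/lt_olsub; exists i.
Qed.

(** * Ordinary ordinal arithmetic *)

Definition ozero : Ord := olsub (fun e : Empty_set => match e with end).
Definition osucc (a : Ord) : Ord := olsub (fun _ : unit => a).
Definition onat (n : nat) : Ord := iter n osucc ozero.
Definition oomega : Ord := olsub onat.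
Definition olimit (a : Ord) : Prop := a <> ozero /\ forall b, a <> osucc b.

Lemma ltS_ord (a b : Ord) : (a < osucc b) = (a <= b).
Proof. by apply/idP/idP => [/lt_olsub[]//|ab]; apply/lt_olsub; exists tt. Qed.

Lemma osucc_inj : injective osucc.
Proof.
move=> a b ab; apply/eqP; rewrite eq_le.
by rewrite -[a <= b]ltS_ord -[b <= a]ltS_ord -ab ltS_ord lexx ab ltS_ord lexx.
Qed.

Fact lt_osucc_eq (a b : Ord) : b = osucc a -> a < b.
Proof. by move->; rewrite ltS_ord. Qed.

Definition orec_body (z : Ord) (s : Ord -> Ord) (b : Ord)
    (rec : forall c, c < b -> Ord) : Ord :=
  if b == ozero then z else
  match pselect (exists c, b = osucc c) with
  | left h => let: exist c e := cid h in s (rec c (lt_osucc_eq e))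
  | right _ => supremum ozero [set x | exists c (h : c < b), x = rec c h]%classic
  end.

Definition orec (z : Ord) (s : Ord -> Ord) : Ord -> Ord :=
  Fix Ord_wf (fun=> Ord) (@orec_body z s).

Lemma orecE z s b : orec z s b = orec_body z s (fun c (_ : c < b) => orec z s c).
Proof.
rewrite /orec Fix_eq // => c f g fg; congr orec_body.
by apply/functional_extensionality_dep => d; apply/functional_extensionality_dep.
Qed.

Lemma orec0 z s : orec z s ozero = z.
Proof. by rewrite orecE /orec_body eqxx. Qed.

Lemma orecS z s a : orec z s (osucc a) = s (orec z s a).
Proof.
rewrite orecE /orec_body; case: eqP => [a0|_].
  have : a < ozero by rewrite -a0 ltS_ord.
  by move=> /lt_olsub[].
case: pselect => [h|[]]; last by exists a.
by case: (cid h) => c /osucc_inj->.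
Qed.

Lemma orec_limit z s a : olimit a ->
  orec z s a = supremum ozero [set orec z s c | c in [set c | c < a]]%classic.
Proof.
move=> [/eqP/negPf a0 aS]; rewrite orecE /orec_body a0.
case: pselect => [[c /aS]//|_]; congr supremum.
apply/seteqP; split=> x /=; first by move=> [c [h ->]]; exists c.
by move=> [c h <-]; exists c, h.
Qed.

Definition oadd (a b : Ord) : Ord := orec a osucc b.
Definition omul (a b : Ord) : Ord := orec ozero (fun c => oadd c a) b.
Definition oexp (a b : Ord) : Ord := orec (onat 1) (fun c => omul c a) b.

Notation "a + b" := (oadd a b) : ord_scope.
Notation "a * b" := (omul a b) : ord_scope.
Notation "a ^ b" := (oexp a b) : ord_scope.

(* The first term of the list is the leftmost summand. *)
Definition osum (s : seq Ord) : Ord := foldr oadd ozero s.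

(* [\sum p^d a_d], in decreasing order of the exponents d *)
Definition expansion (p : nat) (a : {fsfun Ord -> nat with 0%N}) : Ord :=
  osum [seq (onat p ^ d * onat (a d))%ord
       | d <- sort (fun d e : Ord => e <= d) (finsupp a)].

(** * The chain of fields *)

Section Structures.
Local Open Scope ring_scope.

(* [lab] identifies the ring K with the ordinal s, and carries the operations
   of K to [add] and [mul]; it is the inverse of the bijection theta from s to
   K through which operations are transported. *)
Definition transported (K : pzRingType) (lab : K -> Ord) (s : Ord)
    (add mul : Ord -> Ord -> Ord) : Prop :=
  [/\ injective lab,
      forall a : Ord, (a < s)%O <-> exists x, lab x = a,
      {morph lab : x y / x + y >-> add x y} &
      {morph lab : x y / x * y >-> mul x y}].

Definition rootless (F : fieldType) (q : {poly F}) : Prop :=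
  forall x, ~~ root q x.

Definition rootless_degree (F : fieldType) (n : nat) : Prop :=
  exists q : {poly F}, size q = n.+1 /\ rootless q.

Definition least_rootless_degree (F : fieldType) (n : nat) : Prop :=
  [/\ (0 < n)%N, rootless_degree F n &
      forall m, (0 < m)%N -> rootless_degree F m -> (n <= m)%N].

Definition lex_lt (F : fieldType) (lab : F -> Ord) (h k : {poly F}) : Prop :=
  exists i, (lab h`_i < lab k`_i)%O /\ forall j, (i < j)%N -> h`_j = k`_j.

Definition lex_earliest (F : fieldType) (lab : F -> Ord) (n : nat)
    (h : {poly F}) : Prop :=
  [/\ (size h <= n)%N, rootless ('X^n - h) &
      forall k : {poly F}, (size k <= n)%N -> rootless ('X^n - k) ->
        k = h \/ lex_lt lab h k].

(* [\sum_(i < n) phi^i alpha_i], the alpha_i being the coefficients of q *)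
Definition poly_ord (F : fieldType) (lab : F -> Ord) (phi : Ord) (n : nat)
    (q : {poly F}) : Ord :=
  osum [seq (phi ^ onat i * lab q`_i)%ord | i <- rev (iota 0 n)].

(* The pair (r, q) stands for the partial fraction decomposition with
   coefficient r (alpha, n) on 1 / (x - alpha)^(n + 1) and polynomial part q. *)
Definition pfrac (F : fieldType) (r : {fsfun F * nat -> F with 0})
    (q : {poly F}) : {fraction {poly F}} :=
  \sum_(u <- finsupp r)
     tofrac (r u)%:P / tofrac (('X - u.1%:P) ^+ u.2.+1) + tofrac q.

Definition pole_exponent (F : fieldType) (lab : F -> Ord) (u : F * nat) : Ord :=
  (oomega + (oomega * lab u.1 + onat u.2))%ord.

Definition pfrac_ord (F : fieldType) (lab : F -> Ord) (phi : Ord)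
    (r : {fsfun F * nat -> F with 0}) (q : {poly F}) : Ord :=
  osum ([seq (phi ^ pole_exponent lab u * lab (r u))%ord
        | u <- sort (fun u w => pole_exponent lab w <= pole_exponent lab u)%O
                    (finsupp r)]
        ++ [seq (phi ^ onat m * lab q`_m)%ord | m <- rev (iota 0 (size q))]).

(* [phi D] is the D-th ordinal of the chain; as a field it is presented by a
   field [fld D] together with a bijection [lab D] from [fld D] to [phi D].
   There is a single pair [onp_add], [onp_mul] of operations on all ordinals, so the
   operations of each field of the chain extend those of the earlier ones.
   In [succ_algebraic], 'X^n - h is monic of positive degree, so that
   {poly %/ ('X^n - h)} is the quotient by 'X^n - h itself. *)
Record Onp (p : nat) := {
  phi : Ord -> Ord;
  onp_add : Ord -> Ord -> Ord;
  onp_mul : Ord -> Ord -> Ord;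
  fld : Ord -> fieldType;
  lab : forall D, fld D -> Ord;
  phi_lt : {homo phi : D E / (D < E)%O};
  fldP : forall D, transported (@lab D) (phi D) onp_add onp_mul;
  fld_pchar : forall D, p \in [pchar fld D];
  phi_zero : phi ozero = onat p;
  add_zero : forall i j, (i < p)%N -> (j < p)%N ->
    onp_add (onat i) (onat j) = onat ((i + j) %% p);
  mul_zero : forall i j, (i < p)%N -> (j < p)%N ->
    onp_mul (onat i) (onat j) = onat ((i * j) %% p);
  phi_limit : forall D, olimit D ->
    phi D = supremum ozero [set phi E | E in [set E | (E < D)%O]]%classic;
  succ_algebraic : forall D, ~ GRing.closed_field_axiom (fld D) ->
    exists (n : nat) (h : {poly fld D}),
      [/\ least_rootless_degree (fld D) n, lex_earliest (@lab D) n h,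
          phi (osucc D) = (phi D ^ onat n)%ord &
          exists tau : {poly %/ ('X^n - h)} -> Ord,
            transported tau (phi (osucc D)) onp_add onp_mul /\
            forall q : {poly fld D}, (size q <= n)%N ->
              tau (in_qpoly ('X^n - h) q) = poly_ord (@lab D) (phi D) n q];
  succ_transcendental : forall D, GRing.closed_field_axiom (fld D) ->
    phi (osucc D) = (phi D ^ phi D)%ord /\
    exists tau : {fraction {poly fld D}} -> Ord,
      transported tau (phi (osucc D)) onp_add onp_mul /\
      forall r q, tau (pfrac r q) = pfrac_ord (@lab D) (phi D) r q
}.

End Structures.

(* Main.v *)
(** Call an exponent g digitwise if [p^g k + a] = [p^g k] + a for k < p and
    a < [p^g], and [p^g k] + [p^g l] = [p^g ((k + l) mod p)].  Base-p expansions
    add without carries as soon as every exponent is digitwise, which is shown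
    by induction along the chain, together with the fact that every phi is an
    ordinal power [p^b].  At a successor, [phi^N] is the next ordinal, with N
    finite or N = phi; the bijection theta turns base-phi expansions into sums
    of monomials or of partial fractions, so that base-phi expansions add
    coefficientwise.  Writing an exponent as g = [b e + f] with f < b gives
    [p^g] = [phi^e p^f], and the exponent f is digitwise by induction. *)

From HB Require Import structures.
Require Import Defs.
From mathcomp Require Import all_boot all_order all_algebra.
From mathcomp Require Import fraction qpoly finmap.
From mathcomp Require Import boolp classical_sets.

Set Implicit Arguments.
Unset Strict Implicit.
Unset Printing Implicit Defensive.

Import Order.TTheory GRing.Theory.

(** * Ordinal arithmetic *)

Section Ordinals.
Local Open Scope order_scope.
Local Open Scope ord_scope.
Implicit Types a b c d e r x y z : Ord.

Lemma Ord_ind (P : Ord -> Prop) :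
  (forall a, (forall b, b < a -> P b) -> P a) -> forall a, P a.
Proof. exact: well_founded_ind Ord_wf P. Qed.

Lemma Ord_least (P : Ord -> Prop) a : P a ->
  exists b, P b /\ forall c, c < b -> ~ P c.
Proof.
elim/Ord_ind: a => a IH Pa.
have [[b [ba Pb]]|nP] := pselect (exists b, b < a /\ P b); first exact: IH Pb.
by exists a; split=> // c ca Pc; apply: nP; exists c.
Qed.

Lemma Ord_le_ext a b : (forall x, x < a -> x < b) -> a <= b.
Proof. by move=> ab; rewrite leNgt; apply/negP => /ab; rewrite ltxx. Qed.

Lemma Ord_eq_ext a b : (forall x, x < a <-> x < b) -> a = b.
Proof. by move=> ab; apply: le_anti; rewrite !Ord_le_ext // => x /ab. Qed.

Lemma lt_osucc a : a < osucc a.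
Proof. by rewrite ltS_ord. Qed.

Lemma osucc_le a b : (osucc a <= b) = (a < b).
Proof. by rewrite leNgt ltS_ord -ltNge. Qed.

Lemma ozero_le a : ozero <= a.
Proof. by apply/olsub_le. Qed.

Lemma lt_ozero a : (a < ozero) = false.
Proof. by rewrite ltNge ozero_le. Qed.

Lemma ozero_lt a : (ozero < a) = (a != ozero).
Proof. by rewrite lt_neqAle ozero_le andbT eq_sym. Qed.

Lemma Ord_cases a : [\/ a = ozero, exists b, a = osucc b | olimit a].
Proof.
have [->|a0] := pselect (a = ozero); first by constructor 1.
have [|aS] := pselect (exists b, a = osucc b); first by constructor 2.
by constructor 3; split=> // b ab; apply: aS; exists b.
Qed.

Lemma olimit_gt0 a : olimit a -> ozero < a.
Proof. by case=> /eqP; rewrite -ozero_lt. Qed.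

Lemma olimit_osucc a b : olimit a -> b < a -> osucc b < a.
Proof.
by move=> [_ aS] ba; rewrite lt_neqAle osucc_le ba andbT eq_sym; apply/eqP/aS.
Qed.

(** [supremum] chooses among least upper bounds, so one has to be exhibited first: it is the least
    of the upper bounds, which exist because of [b]. *)
Lemma lt_supremum (A : set Ord) b x : (A !=set0)%classic ->
  (forall a, A a -> a <= b) ->
  (x < supremum ozero A)%classic <-> exists2 a, A a & x < a.
Proof.
move=> A0 Ab; rewrite /supremum; case: eqP => [AE|_].
  by move: A0; rewrite AE => -[].
have [c [cA lc]] := @Ord_least (fun c => forall a, A a -> a <= c) b Ab.
have sc : supremums A c.
  split=> // d dA; rewrite leNgt; apply/negP => /lc; exact.
case: xgetP => [y _ [yA ly]|/(_ c) //].
split=> [xy|[a Aa xa]]; last exact/(lt_le_trans xa)/yA.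
apply/not_exists2P => nA; move: xy; rewrite ltNge => /negP; apply; apply: ly.
by move=> a Aa; case: (nA a) => // /negP; rewrite -leNgt.
Qed.

(* This one characterisation replaces the zero-successor-limit case
   distinctions in all the inductions below. *)
Lemma lt_orec z (s : Ord -> Ord) b x : (forall y, y <= s y) ->
  x < orec z s b <-> x < z \/ exists2 c, c < b & x < s (orec z s c).
Proof.
move=> infl; elim/Ord_ind: b x => b IH x.
have [bE|[c bE]|blim] := Ord_cases b.
- by rewrite bE orec0; split=> [|[//|[c]]]; [left|rewrite lt_ozero].
- rewrite bE orecS; split=> [?|]; first by right; exists c => //; apply: lt_osucc.
  case=> [xz|[d]].
    apply: lt_le_trans (infl _); apply/IH; last by left.
    by rewrite bE lt_osucc.
  rewrite ltS_ord le_eqVlt => /predU1P[->//|dc xd].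
  apply: lt_le_trans (infl _); apply/IH; last by right; exists d.
  by rewrite bE lt_osucc.
(* Replacement bounds the values below the limit, so that their supremum is a genuine one. *)
have [u uP] := Ord_replacement b (orec z s).
rewrite orec_limit // (@lt_supremum _ u); first last.
- by move=> _ [c cb <-]; apply: uP.
- by exists (orec z s ozero); exists ozero => //; apply: olimit_gt0.
split.
  move=> [_ [c cb <-]] /(IH _ cb) [|[d dc xd]]; first by left.
  by right; exists d => //; apply: lt_trans cb.
case=> [xz|[c cb xc]].
  by exists z => //; exists ozero; [apply: olimit_gt0|rewrite orec0].
exists (s (orec z s c)) => //; exists (osucc c); last by rewrite orecS.
exact: olimit_osucc.
Qed.

(** * Ordinal addition *)

Lemma oadd0 a : a + ozero = a. Proof. exact: orec0. Qed.
Lemma oaddS a b : a + osucc b = osucc (a + b). Proof. exact: orecS. Qed.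
Lemma omul0 a : a * ozero = ozero. Proof. exact: orec0. Qed.
Lemma omulS a b : a * osucc b = a * b + a. Proof. exact: orecS. Qed.
Lemma oexp0 a : a ^ ozero = onat 1. Proof. exact: orec0. Qed.
Lemma oexpS a b : a ^ osucc b = a ^ b * a. Proof. exact: orecS. Qed.

Lemma lt_oadd a b x : x < a + b <-> x < a \/ exists2 c, c < b & x <= a + c.
Proof.
rewrite lt_orec => [|y]; last exact/ltW/lt_osucc.
by split=> -[|[c cb xc]]; [left|right; exists c; rewrite // -ltS_ord
  |left|right; exists c; rewrite // ltS_ord].
Qed.

Lemma ltoD2l a b c : (a + b < a + c) = (b < c).
Proof.
have H u v : u < v -> a + u < a + v.
  by move=> uv; apply/lt_oadd; right; exists u.
apply/idP/idP => [|/H//]; apply: contraTT; rewrite -!leNgt le_eqVlt.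
by move=> /predU1P[->//|/H/ltW].
Qed.

Lemma leoD2l a b c : (a + b <= a + c) = (b <= c).
Proof. by rewrite !leNgt ltoD2l. Qed.

Lemma oaddI a : injective (oadd a).
Proof. by move=> b c e; apply: le_anti; rewrite -(leoD2l a b) -(leoD2l a c) e lexx. Qed.

Lemma leo_addr a b : a <= a + b.
Proof. by rewrite -{1}[a]oadd0 leoD2l ozero_le. Qed.

Lemma leo_addl a b : b <= a + b.
Proof.
elim/Ord_ind: b => b IH; apply: Ord_le_ext => x xb; apply/lt_oadd.
by right; exists x => //; apply: IH.
Qed.

Lemma leoD2r c a b : a <= b -> a + c <= b + c.
Proof.
move=> ab; elim/Ord_ind: c => c IH; apply: Ord_le_ext => x /lt_oadd[xa|[d dc xd]].
  by apply/lt_oadd; left; apply: lt_le_trans ab.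
by apply/lt_oadd; right; exists d => //; apply: le_trans (IH _ dc).
Qed.

Lemma oaddA a b c : a + (b + c) = a + b + c.
Proof.
elim/Ord_ind: c => c IH; apply: Ord_eq_ext => x; rewrite !lt_oadd; split.
  case=> [|[y /lt_oadd[yb|[c' c'c yc]] xy]]; first by left; left.
    by left; right; exists y.
  by right; exists c' => //; rewrite -IH // (le_trans xy) // leoD2l.
case=> [[|[y yb xy]]|[c' c'c xc]]; first by left.
  by right; exists y => //; apply: lt_le_trans (leo_addr _ _).
by right; exists (b + c'); rewrite ?ltoD2l // IH.
Qed.

Lemma add0o a : ozero + a = a.
Proof.
elim/Ord_ind: a => a IH; apply: Ord_eq_ext => x; rewrite lt_oadd lt_ozero; split.
  by case=> // -[c ca]; rewrite IH // => xc; apply: le_lt_trans ca.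
by move=> xa; right; exists x => //; rewrite IH.
Qed.

(** The difference is the least [c] with [b <= a + c]: minimality puts every [a + d] with [d < c]
    strictly below [b]. *)
Lemma oadd_subr a b : a <= b -> exists c, b = a + c.
Proof.
move=> ab; have [c [bc cmin]] := @Ord_least (fun c => b <= a + c) b (leo_addl _ _).
exists c; apply: le_anti; rewrite bc Ord_le_ext // => x /lt_oadd[xa|[d dc xd]].
  exact: lt_le_trans ab.
by rewrite (le_lt_trans xd) // ltNge; apply/negP/cmin.
Qed.

(** * Ordinal multiplication and division with remainder *)

Lemma lt_omul a b x : x < a * b <-> exists2 c, c < b & x < a * c + a.
Proof.
rewrite lt_orec => [|y]; last exact: leo_addr.
by rewrite lt_ozero; split=> [[]|]; last right.
Qed.

Lemma leoM2l c a b : a <= b -> c * a <= c * b.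
Proof.
move=> ab; apply: Ord_le_ext => x /lt_omul[d da xd]; apply/lt_omul; exists d => //.
exact: lt_le_trans ab.
Qed.

Lemma ltoM2l c a b : ozero < c -> a < b -> c * a < c * b.
Proof.
by move=> c0 ab; apply/lt_omul; exists a => //; rewrite -{1}[c * a]oadd0 ltoD2l.
Qed.

Lemma leo_mull a b : ozero < a -> b <= a * b.
Proof.
move=> a0; elim/Ord_ind: b => b IH; apply: Ord_le_ext => x xb; apply/lt_omul.
by exists x => //; rewrite (le_lt_trans (IH _ xb)) // -{1}[a * x]oadd0 ltoD2l.
Qed.

Lemma omul1 a : a * onat 1 = a.
Proof. by rewrite omulS omul0 add0o. Qed.

Lemma mul1o a : onat 1 * a = a.
Proof.
elim/Ord_ind: a => a IH; apply: Ord_eq_ext => x; rewrite lt_omul; split.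
  move=> [c ca]; rewrite IH // oaddS oadd0 ltS_ord => xc; exact: le_lt_trans ca.
by move=> xa; exists x => //; rewrite IH // oaddS oadd0 lt_osucc.
Qed.

Lemma omulDr a b c : a * (b + c) = a * b + a * c.
Proof.
elim/Ord_ind: c => c IH; apply: Ord_eq_ext => x; rewrite lt_omul lt_oadd; split.
  move=> [y /lt_oadd[yb|[d dc yd]] xy]; first by left; apply/lt_omul; exists y.
  apply/lt_oadd; apply: (lt_le_trans xy).
  apply: (le_trans (leoD2r a (leoM2l a yd))).
  by rewrite IH // -oaddA leoD2l -omulS leoM2l // osucc_le.
case=> [/lt_omul[y yb xy]|[z /lt_omul[d dc zd] xz]].
  by exists y => //; apply: lt_le_trans (leo_addr _ _).
exists (b + d); rewrite ?ltoD2l // IH // -oaddA (le_lt_trans xz) //.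
by rewrite ltoD2l.
Qed.

Lemma omulA a b c : a * (b * c) = a * b * c.
Proof.
elim/Ord_ind: c => c IH; apply: Ord_eq_ext => x; rewrite !lt_omul; split.
  move=> [y /lt_omul[d dc yd] xy]; exists d => //.
  by rewrite -IH // -omulDr; apply/lt_omul; exists y.
move=> [d dc]; rewrite -IH // -omulDr => /lt_omul[y yd xy].
by exists y => //; apply/lt_omul; exists d.
Qed.

Lemma leoM2r c a b : a <= b -> a * c <= b * c.
Proof.
move=> ab; elim/Ord_ind: c => c IH; apply: Ord_le_ext => x /lt_omul[d dc xd].
apply/lt_omul; exists d => //; apply: (lt_le_trans xd).
by rewrite (le_trans (leoD2r _ (IH _ dc))) // leoD2l.
Qed.

(** The quotient is the least [q] with [a < b * q + b], and the remainder is the difference of [a]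
    and [b * q]. *)
Lemma omul_divP a b c : a < b * c ->
  exists q r, [/\ q < c, r < b & a = b * q + r].
Proof.
move=> abc; have [d dc ad] := (lt_omul _ _ _).1 abc.
have [q [aq qmin]] := @Ord_least (fun q => a < b * q + b) d ad.
(* If [a] were below [b * q], some [q' < q] would already satisfy [a < b * q' + b]. *)
have qa : b * q <= a.
  by rewrite leNgt; apply/negP => /lt_omul[q' /qmin].
have [r aE] := oadd_subr qa; exists q, r; split=> //.
  rewrite (le_lt_trans _ dc) // leNgt; apply/negP => /qmin; exact.
by rewrite -(ltoD2l (b * q)) -aE.
Qed.

Lemma omul_div_uniq b q r q' r' : r < b -> r' < b ->
  b * q + r = b * q' + r' -> q = q' /\ r = r'.
Proof.
have H u v s t : s < b -> u < v -> b * u + s < b * v + t.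
  move=> sb uv; apply: lt_le_trans (leo_addr _ _); apply/lt_omul.
  by exists u => //; rewrite ltoD2l.
move=> rb r'b e; case: (ltgtP q q') => [/(H _ _ _ r' rb)|/(H _ _ _ r r'b)|qE].
- by rewrite e ltxx.
- by rewrite e ltxx.
by split=> //; move: e; rewrite qE => /oaddI.
Qed.

(** * Ordinal exponentiation and leading terms *)

Lemma lt_oexp a b x : ozero < a ->
  x < a ^ b <-> x < onat 1 \/ exists2 c, c < b & x < a ^ c * a.
Proof.
(* A positive base makes the recursion step [y * a] inflationary, as [lt_orec] demands. *)
move=> a0; apply: lt_orec => y; rewrite -{1}[y]omul1 leoM2l //.
by rewrite osucc_le.
Qed.

Lemma oexp_gt0 a b : ozero < a -> ozero < a ^ b.
Proof. by move=> a0; apply/lt_oexp => //; left; apply: lt_osucc. Qed.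

Lemma leoX2l a b c : ozero < a -> b <= c -> a ^ b <= a ^ c.
Proof.
move=> a0 bc; apply: Ord_le_ext => x /lt_oexp -/(_ a0)[|[d db xd]].
  by move=> ?; apply/lt_oexp => //; left.
by apply/lt_oexp => //; right; exists d => //; apply: lt_le_trans bc.
Qed.

Lemma ltoX2l a b c : onat 1 < a -> (a ^ b < a ^ c) = (b < c).
Proof.
move=> a1; have a0 : ozero < a by apply: lt_trans a1; apply: lt_osucc.
apply/idP/idP => [|bc]; first by apply: contraTT; rewrite -!leNgt; apply: leoX2l.
apply/lt_oexp => //; right; exists b => //.
by rewrite -{1}[a ^ b]omul1 ltoM2l // oexp_gt0.
Qed.

Lemma leo_exp a b : onat 1 < a -> b <= a ^ b.
Proof.
move=> a1; elim/Ord_ind: b => b IH; apply: Ord_le_ext => x xb.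
by rewrite (le_lt_trans (IH _ xb)) // ltoX2l.
Qed.

Lemma oexpD a b c : ozero < a -> a ^ (b + c) = a ^ b * a ^ c.
Proof.
move=> a0; elim/Ord_ind: c => c IH; apply: Ord_eq_ext => x.
rewrite lt_oexp // lt_omul; split.
  case=> [x1|[y /lt_oadd[yb|[d dc yd]] xy]].
  - exists ozero; first exact: oexp_gt0.
    by rewrite omul0 add0o; apply/lt_oexp => //; left.
  - exists ozero; first exact: oexp_gt0.
    by rewrite omul0 add0o; apply/lt_oexp => //; right; exists y.
  apply/lt_omul; apply: (lt_le_trans xy).
  apply: (@le_trans _ _ (a ^ (b + d) * a)).
    by rewrite leoM2r // leoX2l.
  by rewrite IH // -omulA leoM2l // -oexpS leoX2l // osucc_le.
move=> [z /lt_oexp -/(_ a0)[|[d dc zd]]].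
  rewrite ltS_ord le_eqVlt lt_ozero orbF => /eqP->; rewrite omul0 add0o.
  move=> /lt_oexp-/(_ a0)[|[y yb xy]]; first by left.
  by right; exists y => //; apply: lt_le_trans (leo_addr _ _).
move=> xz; right; exists (b + d); first by rewrite ltoD2l.
by rewrite IH // -omulA; apply/lt_omul; exists z.
Qed.

Lemma oexpM a b c : ozero < a -> a ^ (b * c) = (a ^ b) ^ c.
Proof.
move=> a0; have ab0 := oexp_gt0 b a0.
elim/Ord_ind: c => c IH; apply: Ord_eq_ext => x; rewrite (lt_oexp _ _ a0) (lt_oexp _ _ ab0); split.
  case=> [|[y /lt_omul[d dc yd] xy]]; first by left.
  right; exists d => //; rewrite -IH // -oexpD //.
  by apply/lt_oexp => //; right; exists y.
case=> [|[d dc]]; first by left.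
rewrite -IH // -oexpD // => /lt_oexp-/(_ a0)[|[y yd xy]]; first by left.
by right; exists y => //; apply/lt_omul; exists d.
Qed.

(** This is the leading term of the base-[b] Cantor normal form: [d] is the least exponent with
    [a < b ^ d * b], and [x] is the quotient of [a] by [b ^ d]. *)
Lemma oexp_leading a b e : onat 1 < b -> ozero < a -> a < b ^ e ->
  exists d x r, [/\ d < e, ozero < x < b, r < b ^ d & a = b ^ d * x + r].
Proof.
move=> b1 a0 ae; have b0 : ozero < b by apply: lt_trans b1; apply: lt_osucc.
have [|[c ce ac]] := (lt_oexp _ _ b0).1 ae.
  by rewrite ltS_ord leNgt a0.
have [d [ad dmin]] := @Ord_least (fun d => a < b ^ d * b) c ac.
have [x [r [xb rd aE]]] := omul_divP ad.
exists d, x, r; split=> //.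
  rewrite (le_lt_trans _ ce) // leNgt; apply/negP => /dmin; exact.
(* With [x = 0], [a] would equal [r < b ^ d], hence be zero or lie below [b ^ d' * b] for some
   [d' < d]. *)
rewrite xb andbT ozero_lt; apply/eqP => x0.
move: rd; rewrite -[r]add0o -(omul0 (b ^ d)) -x0 -aE => /lt_oexp-/(_ b0)[].
  by rewrite ltS_ord leNgt a0.
by move=> [d' /dmin].
Qed.

(** * Finite ordinals, omega and finite sums *)

Lemma ltn_onat (m n : nat) : (onat m < onat n) = (m < n)%N.
Proof.
elim: n m => [|n IH] m; first by rewrite lt_ozero.
by case: m => [|m]; [rewrite ltS_ord ozero_le|rewrite ltS_ord osucc_le IH].
Qed.

Lemma onat_inj : injective onat.
Proof.
by move=> m n e; case: (ltngtP m n) => //; rewrite -ltn_onat e ltxx.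
Qed.

Lemma lt_onatP a (n : nat) : a < onat n -> exists2 m, (m < n)%N & a = onat m.
Proof.
elim: n => [|n IH]; first by rewrite lt_ozero.
rewrite ltS_ord le_eqVlt => /predU1P[->|/IH[m mn ->]]; first by exists n.
by exists m => //; apply: ltnW.
Qed.

Lemma lt_oomega a : a < oomega <-> exists n, a = onat n.
Proof.
rewrite /oomega lt_olsub; split=> [[n]|[n ->]]; last by exists n.
by rewrite -ltS_ord => /(@lt_onatP _ n.+1)[m _ ->]; exists m.
Qed.

Lemma osum_cat (s t : seq Ord) : osum (s ++ t) = osum s + osum t.
Proof. by elim: s => [|a s IH] /=; rewrite ?add0o // -oaddA -IH. Qed.

End Ordinals.

(** This peels the leading exponent off a decreasing enumeration of a support; antisymmetry makes
    the sorted list unique. *)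
Lemma sort_cons (T : eqType) (leT : rel T) x (s t : seq T) :
  total leT -> transitive leT -> antisymmetric leT ->
  perm_eq t (x :: s) -> {in s, forall y, leT x y} -> sort leT t = x :: sort leT s.
Proof.
move=> leT_total leT_tr leT_asym ts xs.
have -> : sort leT t = sort leT (x :: sort leT s).
  apply/perm_sortP => //; apply: (perm_trans ts).
  by rewrite perm_cons perm_sym perm_sort.
apply: sorted_sort => //=; rewrite path_min_sorted ?sort_sorted //.
by apply/allP => y; rewrite mem_sort => /xs.
Qed.

(** * Digitwise addition along the chain *)

Section Chain.
Local Open Scope order_scope.
Local Open Scope ord_scope.
Variables (p : nat) (S : Onp p).
Local Notation "a (+) b" := (onp_add S a b) : ord_scope.
Local Notation phi := (phi S).
Local Notation lab := (@lab p S _).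
Implicit Types D a b c d e g : Ord.

(** * The additive structure of the whole Class *)

Lemma onp_prime : prime p.
Proof. exact: pcharf_prime (fld_pchar S ozero). Qed.

Lemma phi_le : {homo phi : D E / D <= E}.
Proof. by move=> D E; rewrite le_eqVlt => /predU1P[->//|/(phi_lt S)/ltW]. Qed.

Lemma le_phi D : D <= phi D.
Proof.
elim/Ord_ind: D => D IH; apply: Ord_le_ext => E ED.
exact: le_lt_trans (IH _ ED) (phi_lt S ED).
Qed.

Lemma lt_phi_osucc D : D < phi (osucc D).
Proof. exact: lt_le_trans (lt_osucc _) (le_phi _). Qed.

Lemma lt1_onat : onat 1 < onat p.
Proof. by rewrite ltn_onat prime_gt1 // onp_prime. Qed.

Lemma lt0_onat : ozero < onat p.
Proof. exact: lt_trans (lt_osucc _) lt1_onat. Qed.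

Lemma lt1_phi D : onat 1 < phi D.
Proof.
by apply: (lt_le_trans lt1_onat); rewrite -(phi_zero S) phi_le // ozero_le.
Qed.

Lemma lt0_phi D : ozero < phi D.
Proof. exact: lt_trans (lt_osucc _) (lt1_phi D). Qed.

Lemma lab_surj D a : a < phi D -> exists x : fld S D, lab x = a.
Proof. by case: (fldP S D) => _ aP _ _ /aP. Qed.

Lemma lab_lt D (x : fld S D) : lab x < phi D.
Proof. by case: (fldP S D) => _ aP _ _; apply/aP; exists x. Qed.

Lemma labD D : {morph (fun x : fld S D => lab x) : x y / (x + y)%R >-> x (+) y}.
Proof. by case: (fldP S D). Qed.

Lemma lab_inj D : injective (fun x : fld S D => lab x).
Proof. by case: (fldP S D). Qed.

(** The zero of each field of the chain is its only additive idempotent, and [ozero] is idempotent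
    by arithmetic modulo [p]. This is how [ozero] is recognised as the label of every field's
    zero. *)
Lemma onp_idem_eq0 a : a (+) a = a -> a = ozero.
Proof.
have idem0 D (x : fld S D) : lab x (+) lab x = lab x -> x = 0%R.
  by rewrite -labD => /lab_inj/(canRL (addKr _)); rewrite addNr.
have [x <-] := lab_surj (lt_phi_osucc a) => /idem0->.
have [y y0] := lab_surj (lt0_phi (osucc a)).
have /idem0 yE : lab y (+) lab y = lab y.
  by have := add_zero S (prime_gt0 onp_prime) (prime_gt0 onp_prime); rewrite y0 mod0n.
by rewrite -y0 yE.
Qed.

Lemma transported0 (K : pzRingType) (tau : K -> Ord) s :
  transported tau s (onp_add S) (onp_mul S) -> tau 0%R = ozero.
Proof. by case=> _ _ tauD _; apply: onp_idem_eq0; rewrite -tauD addr0. Qed.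

Lemma lab0 D : lab (0%R : fld S D) = ozero.
Proof. exact: transported0 (fldP S D). Qed.

Lemma lab_eq0 D (x : fld S D) : (lab x == ozero) = (x == 0%R).
Proof. by rewrite -(lab0 D) (inj_eq (@lab_inj D)). Qed.

Lemma onp_add0 : left_id ozero (onp_add S).
Proof.
move=> a; have [x <-] := lab_surj (lt_phi_osucc a).
by rewrite -(lab0 (osucc a)) -labD add0r.
Qed.

(** Since [D <= phi D], any two ordinals are labels in one common field, where the law is known;
    associativity is obtained in the same way. *)
Lemma onp_addC : commutative (onp_add S).
Proof.
move=> a b; pose D := osucc (Order.max a b).
have abD : Order.max a b < phi D by apply: lt_phi_osucc.
move: abD; rewrite gt_max => /andP[/lab_surj[x <-] /lab_surj[y <-]].
by rewrite -!labD addrC.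
Qed.

Lemma onp_addA : associative (onp_add S).
Proof.
move=> a b c; pose D := osucc (Order.max (Order.max a b) c).
have abcD : Order.max (Order.max a b) c < phi D by apply: lt_phi_osucc.
move: abcD; rewrite !gt_max.
move=> /andP[/andP[/lab_surj[x <-] /lab_surj[y <-]] /lab_surj[z <-]].
by rewrite -!labD addrA.
Qed.

Lemma onp_add0r : right_id ozero (onp_add S).
Proof. by move=> a; rewrite onp_addC onp_add0. Qed.

Definition digitwise g : Prop :=
  (forall a k, (k < p)%N -> a < onat p ^ g ->
     onat p ^ g * onat k + a = (onat p ^ g * onat k) (+) a) /\
  (forall k l, (k < p)%N -> (l < p)%N ->
     (onat p ^ g * onat k) (+) (onat p ^ g * onat l)
     = onat p ^ g * onat ((k + l) %% p)).

(** The bound is on the power rather than on [g], so it can be imposed by [phi D] without first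
    writing [phi D] as a power of [p]. *)
Definition digitwise_below b : Prop := forall g, onat p ^ g < b -> digitwise g.

(** * One successor step, abstracting from the two constructions *)

Section Stage.
Variables (D N : Ord) (K : pzRingType) (tau : K -> Ord).
Hypothesis tauP : transported tau (phi D ^ N) (onp_add S) (onp_mul S).

(* [repr e r] is to mean that only exponents below [e] occur in the expansion
   of [tau r] in base [phi D]; [t x] is [theta [phi^e * lab x]]. *)
Variable repr : Ord -> K -> Prop.
Hypothesis repr0 : forall e, repr e 0%R.
Hypothesis repr_cons : forall e, e < N -> exists t : fld S D -> K,
  {morph t : x y / (x + y)%R} /\
  forall x r, x != 0%R -> repr e r ->
    tau (t x + r)%R = phi D ^ e * lab x + tau r /\
    forall d, e < d -> repr d (t x + r)%R.

(** The induction is on [a]: removing the leading term leaves a remainder below [phi D ^ d <= a], to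
    which [repr_cons] restores that term. *)
Lemma repr_exists e a : e <= N -> a < phi D ^ e -> exists2 r, repr e r & tau r = a.
Proof.
elim/Ord_ind: a e => a IH e eN ae.
have [a0|a0] := eqVneq a ozero.
  by exists 0%R => //; rewrite a0 (transported0 tauP).
have [||d [y [b [de /andP[y0 y1] bd aE]]]] := @oexp_leading a (phi D) e _ _ ae.
- exact: lt1_phi.
- by rewrite ozero_lt.
have [x xy] := lab_surj y1.
have da : phi D ^ d <= a.
  rewrite aE (le_trans _ (leo_addr _ _)) // -{1}[phi D ^ d]omul1 leoM2l //.
  by rewrite osucc_le.
have dN : d < N := lt_le_trans de eN.
have [r rd rb] := IH b (lt_le_trans bd da) d (ltW dN) bd.
have [t [_ tP]] := repr_cons dN.
have [|tr rt] := tP x r _ rd; first by rewrite -lab_eq0 xy -ozero_lt.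
by exists (t x + r)%R; [apply: rt|rewrite tr xy rb aE].
Qed.

(** Prefixing a term to the zero element gives [tau (t x) = phi D ^ e * lab x]. Both clauses then
    follow from additivity of [tau] and [t], since every [a < phi D ^ e] is some [tau r]. *)
Lemma phi_expD e : e < N ->
  (forall x a, x < phi D -> a < phi D ^ e ->
     phi D ^ e * x + a = (phi D ^ e * x) (+) a) /\
  (forall x y, x < phi D -> y < phi D ->
     (phi D ^ e * x) (+) (phi D ^ e * y) = phi D ^ e * (x (+) y)).
Proof.
move=> eN; have [t [tD tP]] := repr_cons eN.
have [_ _ tauD _] := tauP; have tau0 := transported0 tauP.
have t0 : t 0%R = 0%R by apply: (addrI (t 0%R)); rewrite -tD !addr0.
have tE x : tau (t x) = phi D ^ e * lab x.
  have [->|x0] := eqVneq x 0%R; first by rewrite t0 tau0 lab0 omul0.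
  by have [] := tP x _ x0 (repr0 e); rewrite addr0 tau0 oadd0.
split=> x y /lab_surj[u <-].
  move=> /(repr_exists (ltW eN))[r re <-]; rewrite -tE -tauD.
  have [->|u0] := eqVneq u 0%R; first by rewrite t0 add0r tau0 add0o.
  by have [-> _] := tP u r u0 re; rewrite tE.
by move=> /lab_surj[v <-]; rewrite -labD -!tE -tauD -tD.
Qed.

Lemma digitwise_stage b : phi D = onat p ^ b -> digitwise_below (phi D) ->
  digitwise_below (phi D ^ N).
Proof.
move=> phiE IH g; rewrite phiE -oexpM ?lt0_onat // ltoX2l ?lt1_onat //.
move=> /omul_divP[e [f [eN fb gE]]].
have pg : onat p ^ g = phi D ^ e * onat p ^ f.
  by rewrite gE oexpD ?lt0_onat // oexpM ?lt0_onat // phiE.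
have pf : onat p ^ f < phi D by rewrite phiE ltoX2l ?lt1_onat.
have [IHA IHB] := IH f pf; have [SA SB] := phi_expD eN.
have pfk k : (k < p)%N -> onat p ^ f * onat k < phi D.
  move=> kp; apply: (@lt_le_trans _ _ (onat p ^ osucc f)).
    by rewrite oexpS ltoM2l ?ltn_onat // oexp_gt0 ?lt0_onat.
  by rewrite phiE leoX2l ?lt0_onat // osucc_le.
rewrite /digitwise pg; split=> [a k kp|k l kp lp].
  (* Dividing [a] by [phi D ^ e] gives a quotient [y < onat p ^ f], to which the induction
     hypothesis at [f] applies; [SA] then splits off the remainder [r]. *)
  move=> /omul_divP[y [r [yf re ->]]].
  have yphi := lt_trans yf pf.
  (* [SA] asks that the coefficient, a sum in the Class, stay below [phi D]: it is the label of a
     sum in [fld S D]. *)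
  rewrite oaddA -!omulA -omulDr IHA // SA //; last first.
    have [u <-] := lab_surj (pfk k kp); have [v <-] := lab_surj yphi.
    by rewrite -labD lab_lt.
  by rewrite -SB ?pfk // -onp_addA SA.
by rewrite -!omulA SB ?pfk // IHB.
Qed.

End Stage.

(** * Algebraic extensions: polynomials modulo ['X^n - h] *)

Section Algebraic.
Variables (D : Ord) (n : nat).

(** The additional leading terms have zero coefficients, whose label is [ozero]. This lets
    polynomials of different sizes be compared at one length. *)
Lemma poly_ord_widen (q : {poly fld S D}) (m k : nat) : (m <= k)%N ->
  (forall j, q`_j != 0 -> (j < m)%N)%R ->
  poly_ord (@Defs.lab p S D) (phi D) k q = poly_ord (@Defs.lab p S D) (phi D) m q.
Proof.
move=> mk qm; rewrite -(subnKC mk) /poly_ord iotaD rev_cat map_cat osum_cat.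
rewrite -[RHS]add0o; congr (_ + _).
have : all (fun j => m <= j)%N (rev (iota (0 + m) (k - m))).
  by apply/allP => j; rewrite mem_rev mem_iota add0n => /andP[].
elim: (rev _) => //= j l IH /andP[mj /IH->].
have [->|/qm] := eqVneq (q`_j)%R 0%R; first by rewrite lab0 omul0 add0o.
by rewrite ltnNge mj.
Qed.

(** Cut down to lengths [m.+1] and [m], the two expansions differ by exactly the leading term. *)
Lemma poly_ord_cons (q : {poly fld S D}) (m k : nat) (x : fld S D) : (m < k)%N ->
  (forall j, q`_j != 0 -> (j < m)%N)%R ->
  poly_ord (@Defs.lab p S D) (phi D) k (x *: 'X^m + q)%R
  = phi D ^ onat m * lab x + poly_ord (@Defs.lab p S D) (phi D) k q.
Proof.
move=> mk qm; have qm0 : (q`_m = 0)%R.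
  by apply/eqP; apply/negPn/negP => /qm; rewrite ltnn.
rewrite (@poly_ord_widen _ m.+1 k) //; last first.
  move=> j; rewrite coefD coefZ coefXn; have [->|jm] := eqVneq j m => //.
  by rewrite mulr0 add0r => /qm/leqW.
rewrite (@poly_ord_widen q m k) // ?(ltnW mk) //.
rewrite /poly_ord -addn1 iotaD rev_cat /= add0n coefD coefZ coefXn eqxx mulr1 qm0 addr0.
congr (_ + osum _); apply/eq_in_map => j; rewrite mem_rev mem_iota => /andP[_ jm].
by rewrite coefD coefZ coefXn ltn_eqF // mulr0 add0r.
Qed.

Lemma digitwise_algebraic (h : {poly fld S D}) b
    (tau : {poly %/ ('X^n - h)%R} -> Ord) :
  transported tau (phi D ^ onat n) (onp_add S) (onp_mul S) ->
  (forall q : {poly fld S D}, (size q <= n)%N ->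
    tau (in_qpoly ('X^n - h)%R q) = poly_ord (@Defs.lab p S D) (phi D) n q) ->
  phi D = onat p ^ b -> digitwise_below (phi D) -> digitwise_below (phi D ^ onat n).
Proof.
move=> tauP tauE.
(* The size bound keeps the representative reduced, which is where [tau] is given by [poly_ord]. *)
pose repr (e : Ord) r := exists q : {poly fld S D}, [/\ (size q <= n)%N,
  r = in_qpoly ('X^n - h)%R q & forall i, (q`_i != 0)%R -> onat i < e].
apply: (@digitwise_stage _ _ _ _ tauP repr) => [e|e /lt_onatP[m mn ->]].
  by exists 0%R; rewrite size_poly0 raddf0; split=> // i; rewrite coef0 eqxx.
exists (fun x => in_qpoly ('X^n - h)%R (x *: 'X^m)%R); split=> [x y|x r x0].
  by rewrite scalerDl raddfD.
move=> [q [qn -> qm]]; rewrite -raddfD.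
have sq : (size (x *: 'X^m + q)%R <= n)%N.
  rewrite (leq_trans (size_polyD _ _)) // geq_max qn andbT.
  by rewrite (leq_trans (size_scale_leq _ _)) // size_polyXn.
split=> [|d md].
  by rewrite !tauE // poly_ord_cons // => j /qm; rewrite ltn_onat.
exists (x *: 'X^m + q)%R; split=> // i.
rewrite coefD coefZ coefXn; have [->//|im] := eqVneq i m.
by rewrite mulr0 add0r => /qm im'; apply: lt_trans md.
Qed.

End Algebraic.

(** * Transcendental extensions: partial fractions *)

Section Transcendental.
Variable D : Ord.
Local Notation pole_exponent := (pole_exponent (@Defs.lab p S D)).
Local Notation pfrac_ord := (pfrac_ord (@Defs.lab p S D) (phi D)).
Implicit Types (r : {fsfun fld S D * nat -> fld S D with 0%R}).
Implicit Types (q : {poly fld S D}) (u : fld S D * nat).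

Lemma pole_exponent_inj : injective pole_exponent.
Proof.
move=> [x m] [y n] /oaddI/omul_div_uniq[]; try by apply/lt_oomega; eexists.
by move=> /= /lab_inj -> /onat_inj ->.
Qed.

Lemma le_oomega_pole u : oomega <= pole_exponent u.
Proof. exact: leo_addr. Qed.

Lemma oomega_gt0 : ozero < oomega.
Proof. by apply/lt_oomega; exists 0%N. Qed.

(** The exponents below [phi D] are those of the monomials, which are finite, and those of the
    poles, found by dividing the excess over omega by omega. *)
Lemma lt_phiP e : e < phi D ->
  (exists m, e = onat m) \/ exists u, e = pole_exponent u.
Proof.
move=> eD; have [/lt_oomega|we] := ltP e oomega; first by left.
right; have [c eE] := oadd_subr we.
have [a [b [ac /lt_oomega[m bm] cE]]] : exists a b,
    [/\ a < osucc c, b < oomega & c = oomega * a + b].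
  apply: omul_divP; apply: (lt_le_trans (lt_osucc c)).
  exact/leo_mull/oomega_gt0.
(* The quotient is at most [c], hence at most [e < phi D], so it labels a point of the field. *)
have [x xa] : exists x : fld S D, lab x = a.
  apply: lab_surj; apply: (le_lt_trans _ eD); rewrite eE.
  by apply: le_trans (leo_addl _ _); rewrite -ltS_ord.
by exists (x, m); rewrite eE cE bm -xa.
Qed.

(** As [x] is nonzero and [u] is new, [u] joins the support, and its exponent comes first in the
    sorted list. *)
Lemma pfrac_ord_pole r q u (x : fld S D) : x != 0%R ->
  (forall w, r w != 0%R -> pole_exponent w < pole_exponent u) ->
  pfrac_ord [fsfun r with u |-> x] q
  = phi D ^ pole_exponent u * lab x + pfrac_ord r q.
Proof.
move=> x0 ru; have uN : u \notin finsupp r.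
  by rewrite memNfinsupp; apply/negPn/negP => /ru; rewrite ltxx.
rewrite /Defs.pfrac_ord !osum_cat oaddA; congr (_ + _).
rewrite (@sort_cons _ _ u (finsupp r)).
- rewrite /= fsfun_with; congr (_ + osum _); apply/eq_in_map => w.
  rewrite mem_sort => wr; rewrite fsfun_withE; case: eqP => // wu.
  by rewrite -wu wr in uN.
- by move=> v w; apply: le_total.
- by move=> v w z wv vz; apply: le_trans wv.
- by move=> v w; rewrite andbC => /le_anti/pole_exponent_inj.
- apply: uniq_perm; rewrite /= ?fset_uniq ?uN // => w.
  by rewrite finsupp_with (negPf x0) !inE.
- by move=> w; rewrite mem_finsupp => /ru/ltW.
Qed.

Lemma pfrac_pole r q u (x : fld S D) : x != 0%R -> u \notin finsupp r ->
  pfrac [fsfun r with u |-> x] q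
  = (tofrac x%:P / tofrac (('X - u.1%:P) ^+ u.2.+1) + pfrac r q)%R.
Proof.
move=> x0 uN; rewrite /pfrac finsupp_with (negPf x0) big_fsetU1 //= fsfun_with addrA.
congr (_ + _ + _)%R; apply: eq_big_seq => w wr; rewrite fsfun_withE.
by case: eqP => // wu; rewrite -wu wr in uN.
Qed.

Lemma digitwise_transcendental b (tau : {fraction {poly fld S D}} -> Ord) :
  transported tau (phi D ^ phi D) (onp_add S) (onp_mul S) ->
  (forall r q, tau (pfrac r q) = pfrac_ord r q) ->
  phi D = onat p ^ b -> digitwise_below (phi D) -> digitwise_below (phi D ^ phi D).
Proof.
move=> tauP tauE.
pose repr (e : Ord) f := exists r q, [/\ f = pfrac r q,
  forall u, r u != 0%R -> pole_exponent u < e &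
  forall i, (q`_i != 0)%R -> onat i < e].
apply: (@digitwise_stage _ _ _ _ tauP repr) => [e|e].
  exists [fsfun with 0%R], 0%R; split=> [|u|i].
  - by rewrite /pfrac finsupp0 big_seq_fset0 raddf0 addr0.
  - by rewrite fsfunE eqxx.
  - by rewrite coef0 eqxx.
case/lt_phiP => [[m ->]|[u ->]].
  exists (fun x => tofrac (x *: 'X^m)%R); split=> [x y|x _ x0 [r [q [-> rm qm]]]].
    by rewrite scalerDl raddfD.
  (* Pole exponents are at least omega, so a bound [onat m] leaves only a polynomial. *)
  have r0 : finsupp r = fset0.
    apply/fsetP => u; rewrite mem_finsupp inE; apply/negbTE/negP => /rm.
    rewrite ltNge => /negP; apply; apply/ltW; apply: lt_le_trans (le_oomega_pole u).
    by apply/lt_oomega; exists m.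
  have -> : (tofrac (x *: 'X^m)%R + pfrac r q = pfrac r (x *: 'X^m + q))%R.
    by rewrite /pfrac r0 !big_seq_fset0 !add0r raddfD.
  have coefm i : (('X^m : {poly fld S D})`_i = (i == m)%:R)%R by rewrite coefXn.
  have qm' j : (q`_j != 0)%R -> (j < m)%N by move=> /qm; rewrite ltn_onat.
  split=> [|d md].
    have ordE q' : tau (pfrac r q') = poly_ord (@Defs.lab p S D) (phi D) (size q') q'.
      by rewrite tauE /Defs.pfrac_ord r0.
    (* [pfrac_ord] stops at the size of the polynomial, which changes when the monomial is added;
       [k] is a common length exceeding [m]. *)
    pose k := maxn m.+1 (maxn (size q) (size (x *: 'X^m + q)%R)).
    have wid q' : (size q' <= k)%N -> tau (pfrac r q') =
        poly_ord (@Defs.lab p S D) (phi D) k q'.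
      move=> q'k; rewrite ordE (poly_ord_widen q'k) // => j; apply: contraR.
      by rewrite -leqNgt => /(nth_default _)->.
    rewrite !wid ?leq_max ?leqnn ?orbT // poly_ord_cons //.
    by rewrite leq_max leqnn.
  exists r, (x *: 'X^m + q)%R; split=> // [u|i].
    by move=> /rm um; apply: lt_trans md.
  rewrite coefD coefZ coefm; have [->//|im] := eqVneq i m.
  by rewrite mulr0 add0r => /qm im'; apply: lt_trans md.
(* For a pole exponent the new term is a partial fraction, and the polynomial part is unchanged. *)
exists (fun x => tofrac x%:P / tofrac (('X - u.1%:P) ^+ u.2.+1))%R.
split=> [x y|x _ x0 [r [q [-> ru qu]]]].
  by rewrite polyCD raddfD mulrDl.
have uN : u \notin finsupp r.
  by rewrite memNfinsupp; apply/negPn/negP => /ru; rewrite ltxx.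
rewrite -pfrac_pole //; split=> [|d ud]; first by rewrite !tauE pfrac_ord_pole.
exists [fsfun r with u |-> x], q; split=> // [w|i].
  rewrite fsfun_withE; have [->//|_] := eqVneq w u.
  by move=> /ru wu; apply: lt_trans ud.
by move=> /qu iu; apply: lt_trans ud.
Qed.

End Transcendental.

(** * Induction along the chain *)

Lemma lt_phi_limit D a : olimit D -> a < phi D -> exists2 E, E < D & a < phi E.
Proof.
move=> Dlim; rewrite phi_limit // (@lt_supremum _ (phi D)).
- by move=> [_ [E ED <-] aE]; exists E.
- by exists (phi ozero); exists ozero => //; apply: olimit_gt0.
- by move=> _ [E ED <-]; apply/ltW/phi_lt.
Qed.

Lemma digitwise_zero : digitwise ozero.
Proof.
split=> [a k kp|k l kp lp]; rewrite oexp0 !mul1o; last exact: add_zero.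
rewrite ltS_ord le_eqVlt lt_ozero orbF => /eqP->.
by rewrite oadd0 onp_add0r.
Qed.

Lemma digitwise_phi D :
  (exists b, phi D = onat p ^ b) /\ digitwise_below (phi D).
Proof.
elim/Ord_ind: D => D IH.
have [->|[E DE]|Dlim] := Ord_cases D.
- have phi0 : phi ozero = onat p ^ onat 1.
    by rewrite phi_zero oexpS oexp0 mul1o.
  split; first by exists (onat 1).
  move=> g; rewrite phi0 ltoX2l ?lt1_onat // => /lt_onatP[[|//] _ ->].
  exact: digitwise_zero.
- have [[b phiE] phiEd] : (exists b, phi E = onat p ^ b) /\ digitwise_below (phi E).
    by apply: IH; rewrite DE lt_osucc.
  rewrite DE; have [clE|nclE] := pselect (GRing.closed_field_axiom (fld S E)).
    have [-> [tau [tauP tauE]]] := succ_transcendental clE.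
    split; last exact: (digitwise_transcendental tauP tauE phiE).
    by exists (b * phi E); rewrite oexpM ?lt0_onat // -phiE.
  have [n [h [_ _ phiSE [tau [tauP tauE]]]]] := succ_algebraic nclE.
  rewrite phiSE in tauP *.
  split; last exact: (digitwise_algebraic tauP tauE phiE).
  by exists (b * onat n); rewrite oexpM ?lt0_onat // -phiE.
split; last by move=> g /(lt_phi_limit Dlim)[E ED]; have [_] := IH E ED; apply.
(* At a limit, [b] is the least exponent whose power reaches [phi D]. Each [c < b] has its power
   below some [phi E], itself a power of [p], so the power at [osucc c] is still at most
   [phi E < phi D]; this excludes overshooting. *)
have [b [Db bmin]] := @Ord_least (fun b => phi D <= onat p ^ b) (phi D)
  (leo_exp _ lt1_onat).
exists b; apply: le_anti; rewrite Db Ord_le_ext // => x.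
move=> /lt_oexp-/(_ lt0_onat)[|[c /bmin/negP]].
  by move=> x1; apply: lt_trans x1 (lt1_phi D).
rewrite -ltNge => /(lt_phi_limit Dlim)[E ED].
have [[e phiE] _] := IH E ED; rewrite phiE ltoX2l ?lt1_onat // => ce xc.
apply: lt_trans (phi_lt S ED); rewrite phiE (lt_le_trans xc) //.
by rewrite -oexpS leoX2l ?lt0_onat // osucc_le.
Qed.

(** The chain exhausts the ordinals, so every power of [p] lies below some [phi D]. *)
Lemma digitwiseT g : digitwise g.
Proof.
by have [_] := digitwise_phi (osucc (onat p ^ g)); apply; apply: lt_phi_osucc.
Qed.

(** * Base-[p] expansions as sums in the Class *)

HB.instance Definition _ :=
  Monoid.isComLaw.Build Ord ozero (onp_add S) onp_addA onp_addC onp_add0.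

(** The two claims are proved together: turning the leading ordinal sum into a sum in the Class
    requires the tail to lie below [onat p ^ d]. *)
Lemma osum_digits (f : Ord -> nat) (s : seq Ord) :
  (forall d, f d < p)%N -> sorted (fun d e => e < d) s ->
  osum [seq onat p ^ d * onat (f d) | d <- s]
    = \big[onp_add S/ozero]_(d <- s) (onat p ^ d * onat (f d)) /\
  forall g, all (fun d => d < g) s ->
    osum [seq onat p ^ d * onat (f d) | d <- s] < onat p ^ g.
Proof.
move=> fp; elim: s => [_|d s IH /= ds].
  by rewrite big_nil; split=> // g _; apply/oexp_gt0/lt0_onat.
have [IHE IHlt] := IH (path_sorted ds).
have sd : all (fun e => e < d) s.
  by apply: order_path_min ds => e c g ec ge; apply: lt_trans ge ec.
have [dA _] := digitwiseT d; have ltd := IHlt d sd.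
split=> [|g /andP[dg _]]; first by rewrite big_cons dA ?fp // IHE.
apply: (@lt_le_trans _ _ (onat p ^ d * osucc (onat (f d)))).
  by rewrite omulS ltoD2l.
apply: (@le_trans _ _ (onat p ^ osucc d)).
  by rewrite oexpS leoM2l // osucc_le ltn_onat fp.
by rewrite leoX2l ?lt0_onat // osucc_le.
Qed.

(** Summing over any finite superset of the support lets expansions with different supports share
    one index set; the extra terms are [ozero]. *)
Lemma expansion_sum (a : {fsfun Ord -> nat with 0%N}) (A : {fset Ord}) :
  (forall d, a d < p)%N -> (finsupp a `<=` A)%fset ->
  expansion p a = \big[onp_add S/ozero]_(d <- A) (onat p ^ d * onat (a d)).
Proof.
move=> ap aA; rewrite /expansion (proj1 (osum_digits ap _)).
  rewrite (perm_big (finsupp a)) /=; last by rewrite perm_sort.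
  by apply: big_fset_incl => // d _ /fsfun_dflt ->; rewrite omul0.
(* Sorting gives weak decrease only; the absence of repetitions in the support makes it strict. *)
have ge_total : total (fun d e : Ord => e <= d) by move=> d e; apply: le_total.
have : uniq (sort (fun d e : Ord => e <= d) (finsupp a)).
  by rewrite sort_uniq fset_uniq.
have := sort_sorted ge_total (finsupp a).
case: (sort _ _) => // d s; elim: s d => //= e s IH d /andP[ed es].
rewrite inE negb_or => /andP[/andP[de _] us].
by rewrite IH // lt_neqAle ed eq_sym de.
Qed.

End Chain.

Theorem theorem2p2 (p : nat) (p_prime : prime p) (S : Onp p)
    (alpha beta : Ord) (a b : {fsfun Ord -> nat with 0})
    (a_digit : forall d : Ord, a d < p) (b_digit : forall d : Ord, b d < p)
    (alphaE : alpha = expansion p a) (betaE : beta = expansion p b) :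
  exists c : {fsfun Ord -> nat with 0},
    (forall d : Ord, c d < p /\ c d = a d + b d %[mod p]) /\
    onp_add S alpha beta = expansion p c.
Proof.
pose A := (finsupp a `|` finsupp b)%fset.
(* Outside [A] both digits vanish, so the default 0 agrees with the digit formula everywhere. *)
pose c : {fsfun Ord -> nat with 0} := [fsfun d in A => (a d + b d) %% p | 0].
have cE d : c d = (a d + b d) %% p.
  rewrite fsfunE; case: ifPn => //; rewrite inE negb_or => /andP[aN bN].
  by rewrite !fsfun_dflt // mod0n.
have c_digit d : c d < p by rewrite cE ltn_mod prime_gt0.
exists c; split=> [d|]; first by split=> //; rewrite cE modn_mod.
rewrite alphaE betaE (expansion_sum S a_digit (fsubsetUl _ _ : _ `<=` A)%fset).
rewrite (expansion_sum S b_digit (fsubsetUr _ _ : _ `<=` A)%fset).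
(* The support of [c] may be smaller than [A], since digits can cancel modulo [p]; summing over [A]
   absorbs this. *)
rewrite (@expansion_sum _ S c A c_digit) ?finsupp_sub // -big_split /=.
by apply: eq_bigr => d _; rewrite cE; case: (digitwiseT S d) => _ ->.
Qed.
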